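(* Let $P$ be a dcpo such that $\sigma(P\times P)=\sigma(P)\times\sigma(P)$. Then the Scott space $\Sigma P$ is sober if and only if \[ \mathord{\downarrow}(\mathord{\uparrow}x\cap A)\in\Gamma(P)\quad\text{for every } A\in\operatorname{Irr}_c(\Sigma P)\text{ and every } x\in P. \]
   Context: All posets and directed sets are nonempty. A subset $D$ of a poset is directed if any two of its elements have a common upper bound in $D$. A dcpo is a poset in which every directed subset has a supremum. Write $\mathord{\downarrow}x=\{y:y\le x\}$, $\mathord{\uparrow}x=\{y:x\le y\}$, and $\mathord{\downarrow}A=\bigcup_{a\in A}\mathord{\downarrow}a$ (so $\mathord{\downarrow}\emptyset=\emptyset$). For a dcpo $P$, an upper set $U\subseteq P$ is Scott open if for every directed $D\subseteq P$, $\bigvee D\in U$ implies $D\cap U\neq\emptyset$; the Scott open sets form the Scott topology $\sigma(P)$, and $\Sigma P=(P,\sigma(P))$ is the Scott space. $\Gamma(P)$ is the collection of Scott-closed subsets of $P$ (including $\emptyset$), i.e. the lower sets closed under directed suprema. A nonempty Scott-closed set $A$ is irreducible if any two open sets meeting $A$ have an intersection meeting $A$; $\operatorname{Irr}_c(\Sigma P)$ is the set of irreducible Scott-closed sets. $\Sigma P$ is sober if each $A\in\operatorname{Irr}_c(\Sigma P)$ equals $\mathord{\downarrow}a$ for a unique $a\in P$. $\sigma(P\times P)$ is the Scott topology of the coordinatewise order on $P\times P$, and $\sigma(P)\times\sigma(P)$ denotes the ordinary product topology. *)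

(* Defs.v *)
From HB Require Import structures.
From mathcomp Require Import all_boot order all_classical.
From mathcomp Require Import topology.

Set Implicit Arguments.
Unset Strict Implicit.
Unset Printing Implicit Defensive.

Local Open Scope classical_set_scope.
Local Open Scope order_scope.

Section Directed.
Context {d : Order.disp_t} {P : porderType d}.

Definition directed (D : set P) : Prop :=
  D !=set0 /\
  forall x y, D x -> D y -> exists z, [/\ D z, x <= z & y <= z].

Definition upper_set (U : set P) : Prop :=
  forall x y, U x -> x <= y -> U y.

Definition lower_set (A : set P) : Prop :=
  forall x y, A x -> y <= x -> A y.

(* Stated for arbitrary posets, quantifying over those directed sets that have
   a supremum: on a dcpo these are all the directed sets. *)
Definition scott_open (U : set P) : Prop :=
  upper_set U /\
  forall (D : set P) (s : P),
    directed D -> isLub D s -> U s -> D `&` U !=set0.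

Definition up (x : P) : set P := [set y | x <= y].

End Directed.

Definition dcpo {d : Order.disp_t} (P : porderType d) : Prop :=
  [set: P] !=set0 /\
  forall D : set P, directed D -> exists s : P, isLub D s.

(* The type of points of P, carrying the Scott topology. *)
Definition scott {d : Order.disp_t} (P : porderType d) : Type := P.

Section ScottTopology.
Context {d : Order.disp_t} (P : porderType d).

HB.instance Definition _ := Choice.on (scott P).

Let scott_openT : @scott_open d P setT.
Proof. by split=> // D s [[x Dx] _] _ _; exists x. Qed.

Let scott_openI : setI_closed (@scott_open d P).
Proof.
move=> U V [uU oU] [uV oV]; split=> [x y [Ux Vx] xy|D s dD Ds [Us Vs]].
  by split; [exact: uU xy|exact: uV xy].
have [x [Dx Ux]] := oU D s dD Ds Us.
have [y [Dy Vy]] := oV D s dD Ds Vs.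
have [z [Dz xz yz]] := dD.2 x y Dx Dy.
by exists z; split=> //; split; [exact: uU xz|exact: uV yz].
Qed.

Let scott_open_bigU (I : Type) (f : I -> set P) :
  (forall i, scott_open (f i)) -> scott_open (\bigcup_i f i).
Proof.
move=> fo; split=> [x y [i _ fx] xy|D s dD Ds [i _ fs]].
  by exists i => //; exact: (fo i).1 xy.
by have [x [Dx fx]] := (fo i).2 D s dD Ds fs; exists x; split=> //; exists i.
Qed.

HB.instance Definition _ := isOpenTopological.Build (scott P)
  scott_openT scott_openI scott_open_bigU.

Lemma scott_openE : @open (scott P) = @scott_open d P.
Proof. by []. Qed.

Lemma scott_closedP (A : set P) :
  closed (A : set (scott P)) <->
  lower_set A /\
  forall (D : set P) (s : P), directed D -> isLub D s -> D `<=` A -> A s.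
Proof.
rewrite -openC scott_openE; split=> [[uA oA]|[lA cA]].
  split=> [x y Ax yx|D s dD Ds DA].
    by apply: contrapT => nAy; exact: uA yx Ax.
  by apply: contrapT => nAs; have [x [/DA]] := oA D s dD Ds nAs.
split=> [x y nAx xy Ay|D s dD Ds nAs]; first by apply: nAx; exact: lA xy.
apply: contrapT => /set0P/negP/negPn/eqP DA0; apply: nAs; apply: cA dD Ds _.
by move=> x Dx; apply: contrapT => nAx; have : set0 x by rewrite -DA0.
Qed.

Definition sigma : set (set P) := @open (scott P).

(* The product topology of the Scott topologies, as a family of subsets of
   P * P; in contrast, sigma (P *p P) is the Scott topology of the
   coordinatewise order. *)
Definition sigma_prod : set (set (P * P)) := @open (scott P * scott P)%type.

Definition Gamma : set (set P) := [set A | closed (A : set (scott P))].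

End ScottTopology.

Arguments sigma {d} P.
Arguments sigma_prod {d} P.
Arguments Gamma {d} P.

Definition irreducible {T : topologicalType} (A : set T) : Prop :=
  A !=set0 /\
  forall U V : set T, open U -> open V ->
    A `&` U !=set0 -> A `&` V !=set0 -> A `&` (U `&` V) !=set0.

Definition Irr_c (T : topologicalType) : set (set T) :=
  [set A | closed A /\ irreducible A].

Arguments Irr_c T : clear implicits.

Definition scott_sober {d : Order.disp_t} (P : porderType d) : Prop :=
  forall A : set P, Irr_c (scott P) A -> exists! a : P, A = down [set a].

(* Main.v *)
(** For irreducible [A], consider the relation on [P] "[x] and [y] have a common
    upper bound in [A]".  Its sections are the sets [down (up x `&` A)]; when
    these are Scott closed, so is the relation, since separate Scott closedness
    implies joint Scott closedness for the coordinatewise order.  Under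
    [sigma (P *p P) = sigma_prod P], a pair in [A * A] outside the relation has
    a neighbourhood [U * V] disjoint from it; but irreducibility puts some [z]
    in [A], [U] and [V], and [(z, z)] is in the relation.  Hence [A] is directed,
    and is the principal ideal of its supremum. *)

Require Import Defs.
From mathcomp Require Import all_boot order all_classical.
From mathcomp Require Import topology.

Local Open Scope classical_set_scope.

Lemma down_set1 (d : Order.disp_t) (P : porderType d) (a x : P) :
  down [set a] x <-> (x <= a)%O.
Proof. by split=> [[_ [-> //]]|xa]; exists a. Qed.

Section ProductOrder.
Context (d d' : Order.disp_t) (P : porderType d) (Q : porderType d').
Implicit Type D : set (P *p Q)%type.

Lemma directed_fst [D] : directed D -> directed [set p.1 | p in D].
Proof.
move=> [[p Dp] dD]; split; first by exists p.1, p.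
move=> _ _ [u Du <-] [v Dv <-]; have [w [Dw]] := dD u v Du Dv.
rewrite !Order.ProdOrder.leEprod => /andP[uw _] /andP[vw _].
by exists w.1; split=> //; exists w.
Qed.

Lemma directed_snd [D] : directed D -> directed [set p.2 | p in D].
Proof.
move=> [[p Dp] dD]; split; first by exists p.2, p.
move=> _ _ [u Du <-] [v Dv <-]; have [w [Dw]] := dD u v Du Dv.
rewrite !Order.ProdOrder.leEprod => /andP[_ uw] /andP[_ vw].
by exists w.2; split=> //; exists w.
Qed.

(** An upper bound [a] of the first coordinates yields the upper bound [(a, s.2)] of [D], so
    leastness of [s] can be applied to it. *)
Lemma isLub_fst [D s] : isLub D s -> isLub [set p.1 | p in D] s.1.
Proof.
move=> [ubs leasts]; split=> [_ [p /ubs + <-]|a uba].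
  by rewrite Order.ProdOrder.leEprod => /andP[].
suff : (s <= ((a, s.2) : P *p Q)%type)%O.
  by rewrite Order.ProdOrder.leEprod => /andP[].
apply: leasts => p Dp; rewrite Order.ProdOrder.leEprod /=.
apply/andP; split; first by apply: uba; exists p.
by have := ubs p Dp; rewrite Order.ProdOrder.leEprod => /andP[].
Qed.

Lemma isLub_snd [D s] : isLub D s -> isLub [set p.2 | p in D] s.2.
Proof.
move=> [ubs leasts]; split=> [_ [p /ubs + <-]|b ubb].
  by rewrite Order.ProdOrder.leEprod => /andP[].
suff : (s <= ((s.1, b) : P *p Q)%type)%O.
  by rewrite Order.ProdOrder.leEprod => /andP[].
apply: leasts => p Dp; rewrite Order.ProdOrder.leEprod /=.
apply/andP; split; last by apply: ubb; exists p.
by have := ubs p Dp; rewrite Order.ProdOrder.leEprod => /andP[].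
Qed.

(** The supremum is reached one coordinate at a time. For [p], [q] in a directed [D] inside [B], the
    mixed pair [(p.1, q.2)] lies below some [r] in [D], hence is in [B]; closedness in the second
    coordinate gives [(p.1, s2)], and then closedness in the first gives [(s1, s2)]. *)
Lemma Gamma_prod_separately (B : set (P *p Q)%type) :
  (forall x, Gamma Q [set y | B (x, y)]) ->
  (forall y, Gamma P [set x | B (x, y)]) ->
  Gamma (P *p Q)%type B.
Proof.
move=> /(_ _)/scott_closedP cl1 /(_ _)/scott_closedP cl2.
have lB : lower_set B.
  move=> [x y] [x' y'] Bxy; rewrite Order.ProdOrder.leEprod => /andP[/= x'x y'y].
  exact: (cl1 x').1 y y' ((cl2 y).1 x x' Bxy x'x) y'y.
apply/scott_closedP; split=> // D [s1 s2] dD Ds DB.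
apply: ((cl2 s2).2 _ _ (directed_fst dD) (isLub_fst Ds)) => _ [p Dp <-].
apply: ((cl1 p.1).2 _ _ (directed_snd dD) (isLub_snd Ds)) => _ [q Dq <-].
have [r [Dr]] := dD.2 p q Dp Dq.
rewrite !Order.ProdOrder.leEprod => /andP[pr _] /andP[_ qr].
by apply: lB (DB r Dr) _; rewrite Order.ProdOrder.leEprod /= pr qr.
Qed.

End ProductOrder.

Lemma irreducible_directed (d : Order.disp_t) (P : porderType d)
    (sigmaPP : sigma (P *p P)%type = sigma_prod P) (A : set P) :
  irreducible (A : set (scott P)) ->
  (forall x, Gamma P (down (up x `&` A))) -> directed A.
Proof.
move=> [A0 irrA] clA; split=> // x y Ax Ay.
pose B : set (P *p P)%type :=
  [set p | exists z, [/\ A z, (p.1 <= z)%O & (p.2 <= z)%O]].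
suff : B (x, y) by [].
apply: contrapT => nBxy.
have clB : Gamma (P *p P)%type B.
  (* [B] is symmetric, so its sections at [u] in either coordinate are the same set. *)
  apply: Gamma_prod_separately => u.
    suff -> : [set v | B (u, v)] = down (up u `&` A) by exact: clA.
    by apply/seteqP; split=> v [z]; [case|case; case]; exists z.
  suff -> : [set v | B (v, u)] = down (up u `&` A) by exact: clA.
  by apply/seteqP; split=> v [z]; [case|case; case]; exists z.
have : sigma_prod P (~` B) by rewrite -sigmaPP; exact: closed_openC clB.
rewrite /sigma_prod openE => /(_ (x, y) nBxy) [[U V] /= [nU nV] UV].
(* The neighbourhoods are shrunk to open sets, as irreducibility tests only open sets. *)
move: nU nV; rewrite !nbhsE => -[U' [oU' U'x] U'U] [V' [oV' V'y] V'V].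
have [z [Az [U'z V'z]]] : A `&` (U' `&` V') !=set0.
  by apply: irrA => //; [exists x|exists y].
apply: (UV (z, z)); first by split; [exact: U'U|exact: V'V].
by exists z.
Qed.

Theorem proposition5p2 (d : Order.disp_t) (P : porderType d)
    (dcpoP : dcpo P)
    (sigmaPP : sigma (P *p P)%type = sigma_prod P) :
  scott_sober P <->
  (forall (A : set P) (x : P),
     Irr_c (scott P) A -> Gamma P (down (up x `&` A))).
Proof.
split=> [soberP A x irrA|clA A irrA].
  have [a [Aa _]] := soberP A irrA.
  (* Here [A] is the principal ideal of [a]: if [x <= a], then [a] itself lies in [up x]&[A] and
     generates all of [A]; otherwise that intersection is empty. *)
  have [xa|nxa] := boolP (x <= a)%O.
    suff -> : down (up x `&` A) = A by exact: irrA.1.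
    apply/seteqP; split=> y.
      move=> [z [[_ Az] yz]]; move: Az.
      by rewrite Aa => /down_set1 za; apply/down_set1; exact: Order.le_trans za.
    rewrite Aa => /down_set1 ya; exists a; split=> //.
    by split=> //; exact/down_set1.
  suff -> : down (up x `&` A) = set0 by exact: closed0.
  apply/seteqP; split=> // y [z [[xz Az] _]].
  move: Az; rewrite Aa => /down_set1 za.
  by case/negP: nxa; exact: Order.le_trans za.
have dA : directed A.
  by apply: irreducible_directed => // [|x]; [exact: irrA.2|exact: clA].
have [s As] := dcpoP.2 A dA.
have [lA supA] := (scott_closedP A).1 irrA.1.
(* Closure under directed suprema is applied to [A] as a directed subset of itself. *)
have {}sA : A s by exact: supA As _.
exists s; split=> [|b Ab].
  apply/seteqP; split=> x; first by move=> Ax; apply/down_set1; exact: As.1.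
  by move=> /down_set1; exact: lA.
apply/Order.le_anti/andP; split.
  by apply: As.2 => x; rewrite Ab => /down_set1.
by apply: As.1; rewrite Ab; exact/down_set1.
Qed.
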